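(* Let $n,p$ be positive integers with $1\le p\le n$. The map $\phi$ restricted to $S_n(132,\hat 1 2\cdots(p+1))$ is a bijection onto the set of Dyck $n$-paths with no peak at height $p$.
   Context: $S_n$ is the set of permutations of $\{1,\dots,n\}$ in one-line notation. For a string $q$ of distinct numbers, $red(q)$ is obtained by replacing the $j$-th smallest element of $q$ by $j$. $\pi\in S_n$ avoids a pattern $\tau\in S_k$ if no $i_1<\dots<i_k$ satisfy $red(\pi_{i_1}\cdots\pi_{i_k})=\tau$. For a pattern $\tau\in S_k$ with the entry $\tau_i$ marked by a hat, $\pi$ avoids the hatted pattern if for every $j_1<\dots<j_{k-1}$ with $red(\pi_{j_1}\cdots\pi_{j_{k-1}})=red(\tau\backslash\tau_i)$ (where $\tau\backslash\tau_i$ is $\tau$ with the entry $\tau_i$ deleted) there are $t_1<\dots<t_k$ with $\{j_1,\dots,j_{k-1}\}\subseteq\{t_1,\dots,t_k\}$ and $red(\pi_{t_1}\cdots\pi_{t_k})=\tau$. $S_n(T)$ is the set of permutations in $S_n$ avoiding all patterns in $T$. Here $\hat 12\cdots(p+1)$ is the increasing pattern of length $p+1$ with its first entry hatted. A Dyck $n$-path is a lattice path from $(0,0)$ to $(2n,0)$ with $n$ up-steps $(1,1)$ and $n$ down-steps $(1,-1)$ never running below the $x$-axis. A peak is the point created by an up-step immediately followed by a down-step; its height is its $y$-coordinate. The map $\phi$ from $S_n(132)$ to Dyck $n$-paths: given $\pi\in S_n(132)$, start at $(0,0)$ and read $\pi_1,\dots,\pi_n$ from left to right. When $\pi_i$ is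 read, add up-steps (possibly none) until the path reaches height $h_i+1$, where $h_i=|\{\pi_k:\pi_k>\pi_i,\ k>i\}|$, and then add one down-step. (It is known that $\phi$ is a bijection from $S_n(132)$ onto the Dyck $n$-paths.) *)

(* Defs.v *)
From mathcomp Require Import all_boot all_fingroup.
From mathcomp Require Import classical_sets functions.

Set Implicit Arguments.
Unset Strict Implicit.
Unset Printing Implicit Defensive.

(* A permutation of {1, ..., n} is s : 'S_n; since 'I_n is {0, ..., n-1}, both
   positions and values are shifted by one, and the shift of the values is
   undone in the words below.
   A choice of positions i_1 < ... < i_k is given by the set {i_1, ..., i_k},
   whose enumeration is increasing. *)
Definition subword n (s : 'S_n) (I : {set 'I_n}) : seq nat :=
  [seq (s i).+1 | i <- enum I].

Definition oneline n (s : 'S_n) : seq nat := subword s finset.setT.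

Definition red (q : seq nat) : seq nat :=
  [seq (index x (sort leq q)).+1 | x <- q].

(* The size of I is forced to be k by the size of oneline t. *)
Definition occurs_at n k (t : 'S_k) (s : 'S_n) (I : {set 'I_n}) : bool :=
  red (subword s I) == oneline t.

Definition avoids n k (t : 'S_k) (s : 'S_n) : bool :=
  [forall I : {set 'I_n}, ~~ occurs_at t s I].

(* The hatted entry is the one at position i of t. *)
Definition avoids_hat n k (t : 'S_k) (i : 'I_k) (s : 'S_n) : bool :=
  [forall J : {set 'I_n},
     (red (subword s J) == red (subword t (~: [set i])%SET)) ==>
     [exists I : {set 'I_n}, (J \subset I) && occurs_at t s I]].

Definition pat132 : 'S_3 := tperm (inord 1) (inord 2).

Lemma oneline_pat132 : oneline pat132 = [:: 1; 3; 2].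
Proof.
rewrite /oneline /subword finset.enum_setT -enumT !enum_ordSl.
rewrite (size0nil (size_enum_ord 0)) /= !permE /=.
by rewrite -!(inj_eq val_inj) /= !inordK.
Qed.

Lemma oneline1 n : oneline (1%g : 'S_n) = iota 1 n.
Proof.
rewrite /oneline /subword finset.enum_setT -enumT.
rewrite (eq_map (fun i => congr1 (fun j : 'I_n => (j : nat).+1) (perm1 i))).
by rewrite (map_comp succn (@nat_of_ord n)) val_enum_ord (iotaDl 1 0).
Qed.

(* A lattice path is its word of steps: true is the up-step (1, 1) and false
   the down-step (1, -1). *)
Definition lattice_path := seq bool.

Definition ups (w : lattice_path) : nat := count_mem true w.
Definition downs (w : lattice_path) : nat := count_mem false w.

(* Final height of w. The truncated subtraction is exact on paths that stay
   weakly above the x-axis; prefixes of Dyck paths and of phi s below do. *)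
Definition height (w : lattice_path) : nat := ups w - downs w.

Definition dyck n (w : lattice_path) : Prop :=
  [/\ ups w = n, downs w = n &
      forall x, x <= size w -> downs (take x w) <= ups (take x w)].

(* The peak is the point of abscissa x.+1. *)
Definition peak_at_height (w : lattice_path) (h : nat) : Prop :=
  exists x, [/\ x.+1 < size w, nth false w x = true,
                nth false w x.+1 = false & height (take x.+1 w) = h].

Definition larger_after n (s : 'S_n) (i : 'I_n) : nat :=
  #|[set k : 'I_n | (s i < s k) && (i < k)]%SET|.

Definition phi_read n (s : 'S_n) (w : lattice_path) (i : 'I_n) : lattice_path :=
  w ++ nseq ((larger_after s i).+1 - height w) true ++ [:: false].

Definition phi n (s : 'S_n) : lattice_path := foldl (phi_read s) [::] (enum 'I_n).

(* Main.v *)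
(* The path phi s is determined by the heights h_i following its down-steps, and
   (h_i) is a Lehmer code of s; hence phi is injective. A sequence (h_i) codes a
   132-avoiding permutation iff h_(i+1) >= h_i - 1, which is exactly the condition
   for it to be the sequence of heights after the down-steps of a Dyck path.
   If s avoids 132, the entries larger than s_i on its right are increasing, so the
   maximal increasing subsequences are those formed by a left-to-right minimum s_i
   and these h_i entries. Avoiding the hatted pattern means that no maximal
   increasing subsequence has length p, while phi s has a peak at height h_i + 1
   exactly for each left-to-right minimum s_i. *)
Require Import Defs.
From mathcomp Require Import all_boot all_fingroup.
From mathcomp Require Import classical_sets functions.
From mathcomp Require Import zify.
Import fintype boot.finset.

Set Implicit Arguments.
Unset Strict Implicit.
Unset Printing Implicit Defensive.

(** * Lattice paths and the heights after their down-steps *)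

(* [c] is the current height, [hs] lists the heights after the down-steps. *)
Fixpoint build (c : nat) (hs : seq nat) : lattice_path :=
  if hs is h :: hs' then nseq (h.+1 - c) true ++ false :: build h hs' else [::].

Fixpoint decode (c : nat) (w : lattice_path) : seq nat :=
  match w with
  | [::] => [::]
  | true :: w' => decode c.+1 w'
  | false :: w' => c.-1 :: decode c.-1 w'
  end.

Fixpoint dyck_from (c : nat) (w : lattice_path) : bool :=
  match w with
  | [::] => c == 0
  | true :: w' => dyck_from c.+1 w'
  | false :: w' => (0 < c) && dyck_from c.-1 w'
  end.

(** The default in [head true] keeps an up-step that ends the word from counting as a peak. *)
Fixpoint has_peak (p c : nat) (w : lattice_path) : bool :=
  match w with
  | [::] => false
  | true :: w' => (~~ head true w' && (c.+1 == p)) || has_peak p c.+1 w'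
  | false :: w' => has_peak p c.-1 w'
  end.

(** This makes the truncated [h.+1 - c] of [build] exact: the block of up-steps and its down-step
    really lead from height [c] to [h]. *)
Definition step_ok : rel nat := fun c h => c <= h.+1.
(** The block from [c] to [h] creates a peak iff it has at least one up-step, that is [c <= h], and
    this peak is at height [h.+1]. *)
Definition no_peak_step (p : nat) : rel nat := fun c h => ~~ ((c <= h) && (h.+1 == p)).

Lemma dyck_from_nseq c k w :
  0 < c + k -> dyck_from c (nseq k true ++ false :: w) = dyck_from (c + k).-1 w.
Proof.
elim: k c => [|k IH] c /=; first by rewrite addn0 => ->.
by move=> _; rewrite IH ?addSnnS // addnS.
Qed.

Lemma decode_nseq c k w :
  decode c (nseq k true ++ false :: w) = (c + k).-1 :: decode (c + k).-1 w.
Proof. by elim: k c => [|k IH] c /=; rewrite ?addn0 // IH addSnnS. Qed.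

Lemma has_peak_nseq p c k w :
  has_peak p c (nseq k true ++ false :: w) =
    ((0 < k) && (c + k == p)) || has_peak p (c + k).-1 w.
Proof.
elim: k c => [|k IH] c /=; first by rewrite addn0.
rewrite IH -addSnnS; case: k {IH} => [|k] /=; last by [].
by rewrite !addn0.
Qed.

Lemma dyck_from_build c hs :
  path step_ok c hs -> dyck_from c (build c hs) = (last c hs == 0).
Proof.
elim: hs c => [|h hs IH] c //= /andP[ch hsP].
by rewrite dyck_from_nseq subnKC //= IH.
Qed.

Lemma decodeK c hs : path step_ok c hs -> decode c (build c hs) = hs.
Proof.
elim: hs c => [|h hs IH] c //= /andP[ch hsP].
by rewrite decode_nseq subnKC //= IH.
Qed.

Lemma has_peak_build p c hs :
  path step_ok c hs -> has_peak p c (build c hs) = ~~ path (no_peak_step p) c hs.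
Proof.
elim: hs c => [|h hs IH] c //= /andP[ch hsP].
by rewrite has_peak_nseq subnKC //= IH // subn_gt0 ltnS negb_and negbK.
Qed.

Lemma downs_build c hs : downs (build c hs) = size hs.
Proof.
by elim: hs c => [|h hs IH] c //=; rewrite /downs count_cat count_nseq /= -/(downs _) IH.
Qed.

Lemma size_decode c w : size (decode c w) = downs w.
Proof. by elim: w c => [|[] w IH] c //=; rewrite IH. Qed.

Lemma decode_spec c w : dyck_from c w ->
  [/\ path step_ok c (decode c w), last c (decode c w) = 0
    & build c (decode c w) = w].
Proof.
elim: w c => [|[] w IH] c /=; first by move/eqP->.
  move=> /IH; case: (decode c.+1 w) => [|h hs] /=; first by case.
  rewrite /step_ok ltnS => -[/andP[ch ->] -> <-]; split=> //; first by rewrite leqW.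
  by rewrite (subSn ch) subSS.
case: c => [|c] //= /IH[-> -> ->]; split=> //; first by rewrite /step_ok leqnn.
by rewrite subnn.
Qed.

(** The heights drop by at most one at a time and end at 0, so each is at most the number of entries
    after it. This is the bound that characterises Lehmer codes. *)
Lemma nth_path_step c hs i : path step_ok c hs -> last c hs = 0 ->
  i < size hs -> nth 0 hs i < size hs - i.
Proof.
have le_size d ds : path step_ok d ds -> d <= last d ds + size ds.
  elim: ds d => [|e ds IH] d /=; first by rewrite addn0.
  by case/andP=> de /IH eL; rewrite addnS (leq_trans de).
elim: hs c i => [|h hs IH] c [|i] //= /andP[ch hsP] l0 ihs.
  by have := le_size _ _ hsP; rewrite l0.
by rewrite subSS; apply: IH hsP l0 ihs.
Qed.

Lemma dyck_fromP c w :
  reflect (downs w = c + ups w /\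
           forall x, x <= size w -> downs (take x w) <= c + ups (take x w))
          (dyck_from c w).
Proof.
elim: w c => [|b w IH] c /=.
  by rewrite addn0 eq_sym; apply: (iffP eqP) => [->|[]].
case: b => /=.
  apply: (iffP (IH c.+1)) => -[eq_w le_w]; split; rewrite ?add0n.
  - by rewrite /= eq_w; rewrite /ups /=; lia.
  - by case=> [|x] //= /le_w; rewrite /ups /downs /=; lia.
  - by move: eq_w; rewrite /ups /downs /=; lia.
  - by move=> x /(le_w x.+1); rewrite /ups /downs /=; lia.
apply: (iffP andP) => [[c0 /IH[eq_w le_w]]|[eq_w le_w]].
  split; first by move: eq_w; rewrite /ups /downs /=; lia.
  by case=> [|x] //= /le_w; rewrite /ups /downs /=; lia.
(* The prefix of length 1 is a down-step, which forces a positive starting height. *)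
have c0 : 0 < c by have := le_w 1 isT; case: (w) => [|? ?]; rewrite /ups /downs /=; lia.
split=> //; apply/IH; split; first by move: eq_w; rewrite /ups /downs /=; lia.
by move=> x /(le_w x.+1); rewrite /ups /downs /=; lia.
Qed.

(** Along such a word no down-step starts at height 0, so the truncated [c.-1] of [has_peak] is the
    true height. *)
Lemma has_peakP p c w : dyck_from c w ->
  reflect (exists x, [/\ x.+1 < size w, nth false w x = true,
             nth false w x.+1 = false &
             c + ups (take x.+1 w) - downs (take x.+1 w) = p])
          (has_peak p c w).
Proof.
elim: w c => [|b w IH] c /=; first by move=> _; constructor; case=> x [].
case: b => /= [/IH {}IH|/andP[c0 /IH {}IH]].
  apply: (iffP orP) => [[/andP[hw /eqP cp]|/IH[x [xw tx fx <-]]]|].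
  - exists 0; case: w hw {IH} => [|[] w] //= _; split=> //.
    by rewrite /ups /downs /=; lia.
  - by exists x.+1; split=> //; rewrite /ups /downs /=; lia.
  - case=> [[|x]] [xw tx fx xp].
      left; case: w {IH tx} xw fx xp => [|[] w] //= _ _.
      by rewrite /ups /downs /=; lia.
    right; apply/IH; exists x; split=> //.
    by move: xp; rewrite /ups /downs /=; lia.
apply: (iffP IH) => [[x [xw tx fx xp]]|[[|x] [//= xw tx fx xp]]].
  by exists x.+1; split=> //; move: xp; rewrite /ups /downs /=; lia.
by exists x; split=> //; move: xp; rewrite /ups /downs /=; lia.
Qed.

Lemma dyckP n w : dyck n w <-> dyck_from 0 w /\ downs w = n.
Proof.
split=> [[un dn le_w]|[/dyck_fromP[eq_w le_w] dn]].
  by split=> //; apply/dyck_fromP; rewrite un dn.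
by split=> //; rewrite -dn eq_w.
Qed.

Lemma peak_at_heightP p w : dyck_from 0 w -> peak_at_height w p <-> has_peak p 0 w.
Proof. by move=> /(has_peakP p) wP; split=> [?|/wP]; first exact/wP. Qed.

(** * The Lehmer code of a permutation *)

Definition code n (s : 'S_n) : seq nat := [seq larger_after s i | i <- enum 'I_n].

Lemma size_code n (s : 'S_n) : size (code s) = n.
Proof. by rewrite size_map size_enum_ord. Qed.

Lemma nth_code n (s : 'S_n) (i : 'I_n) : nth 0 (code s) i = larger_after s i.
Proof. by rewrite (nth_map i) ?size_enum_ord ?nth_ord_enum. Qed.

Lemma path_code n (s : 'S_n) (e : rel nat) :
  reflect ((forall i : 'I_n, i = 0 :> nat -> e 0 (larger_after s i)) /\
           (forall i j : 'I_n, j = i.+1 :> nat -> e (larger_after s i) (larger_after s j)))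
          (path e 0 (code s)).
Proof.
apply: (iffP (pathP 0)) => [|[e0 eS] i]; rewrite size_code; [move=> eP|move=> ltin].
  split=> [i i0|i j ij].
    by rewrite -nth_code; have := eP i (ltn_ord i); rewrite {1}i0.
  by rewrite -!nth_code; have := eP j (ltn_ord j); rewrite {1}ij.
rewrite (nth_code s (Ordinal ltin)).
case: i ltin => [|i] ltin /=; first exact: e0.
by rewrite (nth_code s (Ordinal (ltnW ltin))); apply: eS.
Qed.

Lemma phi_build n (s : 'S_n) : path step_ok 0 (code s) -> phi s = build 0 (code s).
Proof.
(* Generalised over the path [w] drawn so far; [downs w <= ups w] makes the truncated [height w]
   exact. *)
suff foldl_build w l : downs w <= ups w ->
    path step_ok (height w) [seq larger_after s i | i <- l] ->
    foldl (@phi_read n s) w l = w ++ build (height w) [seq larger_after s i | i <- l].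
  by move=> cP; rewrite /phi foldl_build.
elim: l w => [|i l IH] w /= wP; first by rewrite cats0.
case/andP=> iP lP; set w' := phi_read s w i.
have [uw' dw'] : ups w' = ups w + ((larger_after s i).+1 - height w) /\ downs w' = (downs w).+1.
  by rewrite /ups /downs /w' /phi_read !count_cat !count_nseq /=; lia.
have hw' : height w' = larger_after s i.
  by move: iP; rewrite /step_ok /height uw' dw' /height; lia.
rewrite IH ?hw' // /w' /phi_read -?catA //.
by move: iP; rewrite -/w' uw' dw' /step_ok /height; lia.
Qed.

(** If [s] and [t] agree before [i], the same values remain for both, and the next value is
    determined by how many remaining values exceed it. *)
Lemma larger_after_inj n : injective (fun s : 'S_n => [ffun i => larger_after s i]).
Proof.
move=> s t /ffunP eq_st.
have {}eq_st i : larger_after s i = larger_after t i by have := eq_st i; rewrite !ffunE.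
suff agree m (i : 'I_n) : i < m -> s i = t i by apply/permP => i; apply: (agree n).
elim: m i => [//|m IH] i; rewrite ltnS => leim.
(* [larger_after u i] counts the values above [u i] not taken before [i]. *)
have cardE (u : 'S_n) : larger_after u i =
    #|[set v : 'I_n | (u i < v) && (i < (u^-1)%g v)]%SET|.
  rewrite /larger_after -(card_imset _ (@perm_inj _ u)); congr #|pred_of_set _|.
  apply/setP=> v; rewrite inE; apply/imsetP/idP => [[k]|vP].
    by rewrite inE => kP ->; rewrite permK.
  by exists ((u^-1)%g v); rewrite ?inE permKV.
have notbefore (v : 'I_n) : (i <= (s^-1)%g v) = (i <= (t^-1)%g v).
  rewrite [LHS]leqNgt [RHS]leqNgt; congr (~~ _); apply/idP/idP => vP.
    by rewrite -{1}[v](permKV s) IH ?permK // (leq_trans vP).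
  by rewrite -{1}[v](permKV t) -IH ?permK // (leq_trans vP).
have above (u : 'S_n) (v : 'I_n) : u i < v -> (i < (u^-1)%g v) = (i <= (u^-1)%g v).
  move=> uv; rewrite ltn_neqAle; case: eqP => // eq_i; move: uv.
  by rewrite (ord_inj eq_i) permKV ltnn.
wlog lt_st : s t IH eq_st notbefore / s i < t i.
  move=> wl; case: (ltngtP (s i) (t i)) => [st|ts|/ord_inj //]; first exact: wl.
  by symmetry; apply: wl => // j /IH.
(* Remaining values above [t i] are also above [s i], while [t i] itself is counted for [s] only. *)
have := eq_st i; rewrite !cardE => /eqP; rewrite eqn_leq => /andP[+ _].
rewrite leqNgt => /negP[]; apply: proper_card; apply/properP; split.
  apply/subsetP=> v; rewrite !inE => /andP[tv]; have sv := ltn_trans lt_st tv.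
  by rewrite sv !above // notbefore.
exists (t i); rewrite !inE ?ltnn // lt_st above // notbefore permK /=.
exact: leqnn.
Qed.

Lemma larger_after_lt n (s : 'S_n) (i : 'I_n) : larger_after s i < n - i.
Proof.
have -> : n - i = #|[set k : 'I_n | i <= k]%SET|.
  have := cardsC [set k : 'I_n | i <= k]%SET; rewrite card_ord.
  have -> : #|~: [set k : 'I_n | i <= k]%SET| = i.
    have widen_inj : injective (widen_ord (ltnW (ltn_ord i))).
      by move=> a b /(congr1 val) /= /val_inj.
    rewrite -[RHS](card_ord i) -(card_imset _ widen_inj).
    congr #|pred_of_set _|; apply/setP=> k; rewrite !inE -ltnNge.
    apply/idP/imsetP => [ki|[j _ ->] /=]; last exact: ltn_ord.
    by exists (Ordinal ki) => //; apply: val_inj.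
  by move=> eq_n; lia.
apply: proper_card; apply/properP; split.
  by apply/subsetP => k; rewrite !inE => /andP[_ /ltnW].
by exists i; rewrite !inE ?leqnn // ltnn.
Qed.

(** By counting: the code is an injection from ['S_n] into the product of the ['I_(n - i)], which
    has n! elements, so it is onto. *)
Lemma code_onto n (hs : seq nat) : size hs = n ->
  (forall i, i < n -> nth 0 hs i < n - i) -> exists s : 'S_n, code s = hs.
Proof.
move=> sz_hs hsP.
pose lehmer (s : 'S_n) : {dffun forall i : 'I_n, 'I_(n - i)} :=
  [ffun i => Ordinal (larger_after_lt s i)].
have lehmer_inj : injective lehmer.
  move=> s t /ffunP eq_st; apply: larger_after_inj; apply/ffunP => i.
  by have /(congr1 val) := eq_st i; rewrite !ffunE.
have card_le : #|{dffun forall i : 'I_n, 'I_(n - i)}| <= #|{: 'S_n}|.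
  rewrite card_dep_ffun card_Sn foldrE big_map big_enum /=.
  rewrite fact_prod big_add1 big_mkord (reindex_inj rev_ord_inj) /=.
  by rewrite leq_eqVlt; apply/orP; left; apply/eqP/eq_bigr => i _; rewrite card_ord subKn.
pose f : {dffun forall i : 'I_n, 'I_(n - i)} := [ffun i : 'I_n => Ordinal (hsP i (ltn_ord i))].
have /codomP[s fs] := inj_card_onto lehmer_inj card_le f.
exists s; apply: (@eq_from_nth _ 0); rewrite size_code // => i ltin.
have /ffunP/(_ (Ordinal ltin))/(congr1 val) := fs.
by rewrite !ffunE /= => ->; rewrite (nth_code s (Ordinal ltin)).
Qed.

(** * Pattern avoidance in terms of positions *)

Definition avoids132 n (s : 'S_n) : Prop :=
  forall i j k : 'I_n, i < j -> j < k -> ~ (s i < s k < s j).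

Definition increasing_on n (s : 'S_n) (J : {set 'I_n}) : Prop :=
  {in J &, forall i j : 'I_n, i < j -> s i < s j}.

(** The first occurrence of a value in the sorted word is preceded exactly by the smaller entries,
    so repeated entries do no harm. *)
Lemma redE (q : seq nat) : red q = [seq (count (fun y => y < x) q).+1 | x <- q].
Proof.
apply/eq_in_map => x xq; congr _.+1.
have /seq.permP <- := permEl (perm_sort leq q).
have: x \in sort leq q by rewrite mem_sort.
have := sort_sorted leq_total q; elim: (sort leq q) => [//|y r IH] /= yr.
have le_y z : z \in r -> y <= z by apply/allP: z; apply: order_path_min yr; apply: leq_trans.
have count0 : count (fun z => z < y) r = 0.
  by apply/eqP; rewrite -leqn0 leqNgt -has_count; apply/hasPn => z /le_y; rewrite -leqNgt.
rewrite inE eq_sym; case: eqP => [<-|/eqP neq_yx /= xr]; first by rewrite ltnn count0.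
by rewrite IH ?(path_sorted yr) // ltn_neqAle neq_yx le_y.
Qed.

Lemma red_iota (q : seq nat) k :
  (red q == iota 1 k) = (size q == k) && sorted ltn q.
Proof.
apply/eqP/andP => [qk|[/eqP <- q_lt]].
  split; first by rewrite -(size_iota 1 k) -qk size_map.
  have: sorted ltn (red q) by rewrite qk iota_ltn_sorted.
  rewrite redE sorted_map; apply: sub_sorted => x y /=; rewrite ltnS.
  apply: contraTT; rewrite -!leqNgt => yx; apply: sub_count => z /= zy.
  exact: leq_trans zy yx.
have q_uniq : uniq q by apply: sorted_uniq q_lt => [|x]; [apply: ltn_trans|exact: ltnn].
have q_sort : sort leq q = q.
  by apply: sorted_sort; [apply: leq_trans | apply: sub_sorted q_lt => x y /ltnW].
apply: (@eq_from_nth _ 0); rewrite size_map ?size_iota // => i iq.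
by rewrite (nth_map 0) // q_sort index_uniq // nth_iota.
Qed.

Lemma sorted_enum_set n (J : {set 'I_n}) : sorted (fun i j : 'I_n => i < j) (enum J).
Proof.
have : sorted (fun i j : 'I_n => i < j) (enum 'I_n).
  by have := iota_ltn_sorted 0 n; rewrite -val_enum_ord sorted_map.
rewrite enumT => enP; apply: sorted_filter => // x y z; exact: ltn_trans.
Qed.

Lemma sorted_subword n (s : 'S_n) (J : {set 'I_n}) :
  sorted ltn (subword s J) <-> increasing_on s J.
Proof.
have tr_val : transitive (fun i j : 'I_n => i < j) by move=> ? ? ?; apply: ltn_trans.
have tr_s : transitive (fun i j : 'I_n => s i < s j) by move=> ? ? ?; apply: ltn_trans.
rewrite /subword sorted_map; split=> [sP i j|sP].
  rewrite -!(mem_enum J) => iJ jJ ij.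
  case: (ltngtP (index i (enum J)) (index j (enum J))) => [lt_ij|lt_ji|eq_ij].
  - exact: (sorted_ltn_index tr_s sP).
  - have := sorted_ltn_index tr_val (sorted_enum_set J) _ _ jJ iJ lt_ji.
    by rewrite ltnNge ltnW.
  - by move: ij; rewrite (index_inj i iJ jJ eq_ij) ltnn.
apply: (sub_in_sorted (P := mem J)) (sorted_enum_set J) => //=.
by apply/allP => x; rewrite mem_enum.
Qed.

Lemma occurs_at_id n k (s : 'S_n) (I : {set 'I_n}) :
  occurs_at (1%g : 'S_k) s I <-> #|I| = k /\ increasing_on s I.
Proof.
rewrite /occurs_at oneline1 red_iota size_map -cardE -sorted_subword.
by split=> [/andP[/eqP]|[-> ->]]; rewrite ?eqxx.
Qed.

(** An increasing pattern without its first entry is again increasing, so both conditions on [red]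
    only ask for increasing words of a given length. *)
Lemma avoids_hatP n p (s : 'S_n) :
  avoids_hat (1%g : 'S_p.+1) ord0 s <->
  forall J : {set 'I_n}, #|J| = p -> increasing_on s J ->
    exists I : {set 'I_n}, [/\ J \subset I, #|I| = p.+1 & increasing_on s I].
Proof.
have redE0 : red (subword (1%g : 'S_p.+1) (~: [set ord0])%SET) = iota 1 p.
  apply/eqP; rewrite red_iota size_map -cardE cardsC1 card_ord eqxx /=.
  by apply/sorted_subword => i j _ _; rewrite !perm1.
rewrite /avoids_hat redE0; split=> [/forallP hatP J cJ incJ|hatP].
  have := hatP J; rewrite red_iota size_map -cardE cJ eqxx /=.
  move/sorted_subword: (incJ) => ->; case/existsP=> I /andP[JI /occurs_at_id[cI incI]].
  by exists I.
apply/forallP=> J; apply/implyP; rewrite red_iota size_map -cardE.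
case/andP=> /eqP cJ /sorted_subword incJ.
have [I [JI cI incI]] := hatP J cJ incJ.
by apply/existsP; exists I; rewrite JI; apply/occurs_at_id.
Qed.

Lemma enum_set3 n (i j k : 'I_n) : i < j -> j < k -> enum [set i; j; k]%SET = [:: i; j; k].
Proof.
move=> ij jk; apply: (@irr_sorted_eq _ (fun a b : 'I_n => a < b)).
- by move=> ? ? ?; apply: ltn_trans.
- by move=> x; rewrite /= ltnn.
- exact: sorted_enum_set.
- by rewrite /= ij jk.
- by move=> x; rewrite mem_enum !inE orbA.
Qed.

Lemma red132 a b c : (red [:: a; b; c] == [:: 1; 3; 2]) = (a < c < b).
Proof.
rewrite redE /= !ltnn !eqseq_cons.
by case: (ltngtP a b); case: (ltngtP a c); case: (ltngtP b c) => //=; lia.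
Qed.

Lemma avoids_pat132P n (s : 'S_n) : avoids pat132 s <-> avoids132 s.
Proof.
rewrite /avoids /occurs_at oneline_pat132; split=> [/forallP sP i j k ij jk|sP].
  by have := sP [set i; j; k]%SET; rewrite /subword enum_set3 //= red132 !ltnS => /negP.
apply/forallP => I; apply/negP => IP.
have sz_I : size (enum I) = 3 by move/eqP/(congr1 size): (IP); rewrite !size_map.
move: IP (sorted_enum_set I) sz_I; rewrite /subword.
case: (enum I) => [|i [|j [|k []]]] //= + + _.
rewrite red132 !ltnS => ikj /and3P[ij jk _]; exact: sP ij jk ikj.
Qed.

(** * 132-avoidance and left-to-right minima read off the code *)

Definition after_set n (s : 'S_n) (i : 'I_n) : {set 'I_n} :=
  [set k : 'I_n | (s i < s k) && (i < k)]%SET.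

Lemma ltn_perm_total n (s : 'S_n) (i j : 'I_n) : i != j -> (s j < s i) = ~~ (s i < s j).
Proof.
move=> neq_ij; rewrite -leqNgt [RHS]leq_eqVlt; case: eqP => // /ord_inj/perm_inj eq_ij.
by rewrite eq_ij eqxx in neq_ij.
Qed.

Lemma avoids132_step_ok n (s : 'S_n) : avoids132 s <-> path step_ok 0 (code s).
Proof.
split=> [sP|/path_code[_ sP]].
  apply/path_code; split=> // i j ij; rewrite /step_ok.
  (* An entry other than [j] counted at [i] lies after [j]; were it below [s j], it would complete a
     132 with [i] and [j]. *)
  suff /subset_leq_card sub_ij : after_set s i \subset j |: after_set s j.
    apply: leq_trans sub_ij _; rewrite cardsU1 /larger_after -/(after_set s j).
    by case: (_ \notin _).
  apply/subsetP=> k; rewrite !inE => /andP[sik ik].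
  have [//|neq_kj] := eqVneq k j.
  have jk : j < k by move: neq_kj; rewrite -val_eqE /=; lia.
  rewrite jk andbT ltn_perm_total //=; apply/negP => skj.
  by apply: (sP i j k) => //; rewrite ?sik //; lia.
(* Moving the middle entry [j] of a 132 pattern to the left as far as possible, we
   get [s j.-1 < s k], and the code drops by at least 2 from [j.-1] to [j]. *)
move=> i j k; have [m] := ubnP (j : nat).
elim: m i j k => [//|m IH] i j k; rewrite ltnS => jm ij jk /andP[sik skj].
have ltj' : j.-1 < n by apply: leq_ltn_trans (leq_pred j) (ltn_ord j).
pose j' := Ordinal ltj'.
have ij' : i <= j' by rewrite /=; lia.
have [skj'|sj'k] := ltnP (s k) (s j').
  have neq_ij' : i != j' by apply/eqP => eq_ij'; move: (ltn_trans sik skj'); rewrite eq_ij' ltnn.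
  apply: (IH i j' k) => /=; last by rewrite sik.
  - by lia.
  - by move: neq_ij'; rewrite -val_eqE /=; lia.
  - by lia.
have {}sj'k : s j' < s k.
  rewrite ltn_perm_total -?leqNgt // -val_eqE /=; lia.
have : step_ok (larger_after s j') (larger_after s j) by apply: sP => /=; lia.
rewrite /step_ok leqNgt => /negP[].
(* Both [j] and [k] are counted at [j'] but not at [j], and whatever is counted at [j] is counted at
   [j']. *)
have -> : (larger_after s j).+2 = #|k |: (j |: after_set s j)|.
  rewrite !cardsU1 !inE !ltnn /= add1n.
  have -> : (k == j) = false by rewrite -val_eqE /=; lia.
  by rewrite ltnNge ltnW.
apply: subset_leq_card; apply/subsetP => l; rewrite !inE.
case/or3P => [/eqP->|/eqP->|/andP[sjl jl]]; apply/andP; split=> //=; try lia.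
Qed.

Definition lr_min n (s : 'S_n) (i : 'I_n) : Prop := forall j : 'I_n, j < i -> s i < s j.

(** The code drops strictly at an ascent and not at a descent. The bottom [s j] of a descent from
    [s i] is a left-to-right minimum, as a smaller entry before [i] would form a 132 with [s i] and
    [s j]. *)
Lemma no_peak_lr_min n p (s : 'S_n) : avoids132 s ->
  path (no_peak_step p) 0 (code s) <->
  (forall i, lr_min s i -> (larger_after s i).+1 <> p).
Proof.
move=> sP; split=> [/path_code[s0 sS] i imin /eqP ip|minP].
  case: i imin ip => [[|i] lti] imin ip.
    by have := s0 (Ordinal lti) erefl; rewrite /no_peak_step ip.
  have := sS (Ordinal (ltnW lti)) (Ordinal lti) erefl.
  rewrite /no_peak_step ip andbT => /negP; apply.
  apply/subset_leq_card/subsetP => k; rewrite !inE /= => /andP[sik ik].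
  have sk : s (Ordinal lti) < s k by apply: ltn_trans sik; apply: imin.
  rewrite sk /=; move: ik; rewrite leq_eqVlt => /orP[/eqP eq_ik|//].
  by move: sk; have -> : k = Ordinal lti; [exact: val_inj | rewrite ltnn].
apply/path_code; split=> [i i0|i j ij]; apply/negP => /andP[le_h /eqP hp].
  by apply: minP hp => j; rewrite i0.
apply: minP hp => k kj; rewrite ltn_perm_total; last by rewrite -val_eqE neq_ltn kj.
have sji : s j < s i.
  rewrite ltn_perm_total; last by rewrite -val_eqE /=; lia.
  apply/negP => sij; move: le_h; rewrite leqNgt => /negP[].
  apply: proper_card; apply/properP; split.
    apply/subsetP => l; rewrite !inE => /andP[sjl jl].
    by rewrite (ltn_trans sij sjl); lia.
  by exists j; rewrite !inE ?ltnn // sij; lia.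
have [-> | neq_ki] := eqVneq k i; first by rewrite -leqNgt ltnW.
apply/negP => skj; apply: (sP k i j); rewrite ?skj //; last by lia.
by move: neq_ki; rewrite -val_eqE /=; lia.
Qed.

Lemma increasing_after_set n (s : 'S_n) i :
  avoids132 s -> increasing_on s (i |: after_set s i).
Proof.
move=> sP j k; rewrite !inE => /predU1P[->|/andP[sij ij]] /predU1P[->|/andP[sik ik]] jk.
- by rewrite ltnn in jk.
- by [].
- by have := ltn_trans ij jk; rewrite ltnn.
- rewrite ltn_perm_total; last by rewrite -val_eqE neq_ltn jk orbT.
  by apply/negP => skj; apply: (sP i j k); rewrite // sik.
Qed.

Lemma card_after_setU n (s : 'S_n) i : #|i |: after_set s i| = (larger_after s i).+1.
Proof. by rewrite cardsU1 inE !ltnn. Qed.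

(* In a 132-avoiding permutation the maximal increasing subsequences are the
   sets [i |: after_set s i] with [i] a left-to-right minimum. *)
Lemma avoids_hat_lr_min n p (s : 'S_n) : 0 < p -> avoids132 s ->
  avoids_hat (1%g : 'S_p.+1) ord0 s <->
  (forall i, lr_min s i -> (larger_after s i).+1 <> p).
Proof.
move=> p0 sP; split=> [/avoids_hatP hatP i imin ip|minP].
  (* This set has [p] elements but cannot be extended: a new position before [i] would carry a
     smaller value, against minimality, and one after [i] a larger value, hence would already belong
     to it. *)
  have [||I [/subsetP JI cI incI]] := hatP (i |: after_set s i).
  - by rewrite card_after_setU.
  - exact: increasing_after_set.
  have : (i |: after_set s i) \proper I.
    by rewrite properEcard card_after_setU ip cI leqnn andbT; apply/subsetP.
  have iI : i \in I by apply: JI; rewrite !inE eqxx.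
  case/properP=> _ [k kI]; rewrite !inE negb_or negb_and => /andP[neq_ki].
  case: (ltngtP (i : nat) k) => [ik|ki|/val_inj eq_ik].
  - by rewrite incI.
  - by have := incI _ _ kI iI ki; rewrite ltnNge ltnW ?imin.
  - by rewrite eq_ik eqxx in neq_ki.
apply/avoids_hatP => J cJ incJ.
have /card_gt0P[i0 i0J] : 0 < #|J| by rewrite cJ.
pose i := [arg min_(i < i0 in J) (i : nat)].
have [iJ imin] : i \in J /\ forall j, j \in J -> i <= j.
  by rewrite /i; case: arg_minnP.
have JU : J \subset i |: after_set s i.
  apply/subsetP=> k kJ; rewrite !inE; have [//|neq_ki] := eqVneq k i.
  have ik : i < k by rewrite ltn_neqAle imin // val_eqE eq_sym neq_ki.
  by rewrite ik incJ.
(* If [J] misses an element of the increasing set that starts at [i], add it. Otherwise [J] is that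
   whole set, so [i] is no left-to-right minimum by [minP], and an earlier smaller entry can be put
   in front. *)
have [sub_UJ|/subsetPn[k kU kJ]] := boolP (i |: after_set s i \subset J); last first.
  exists (k |: J); split; first exact: subsetUr.
    by rewrite cardsU1 kJ cJ.
  have kJU : k |: J \subset i |: after_set s i by rewrite subUset sub1set kU.
  by move=> a b /(subsetP kJU) aU /(subsetP kJU) bU; apply: (increasing_after_set sP aU bU).
have {JU sub_UJ} eqJ : J = i |: after_set s i by apply/eqP; rewrite eqEsubset JU.
have [/forallP imin'|] := boolP [forall j : 'I_n, (j < i) ==> (s i < s j)].
  have := minP i; rewrite -card_after_setU -eqJ cJ => /(_ _ erefl)[] j ji.
  by have := imin' j; rewrite ji.
case/forallPn=> j; rewrite negb_imply => /andP[ji].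
rewrite -ltn_perm_total => [sji|]; last by rewrite -val_eqE neq_ltn ji orbT.
exists (j |: J); split; first exact: subsetUr.
  rewrite cardsU1 cJ; case: (boolP (j \in J)) => // /imin.
  by rewrite leqNgt ji.
have lej k : k \in J -> j < k /\ s j < s k.
  rewrite eqJ !inE => /predU1P[->//|/andP[sik ik]].
  by rewrite (ltn_trans ji ik) (ltn_trans sji sik).
move=> a b /setU1P[->|aJ] /setU1P[->|bJ]; last exact: incJ.
- by rewrite ltnn.
- by case: (lej b bJ).
- by move=> aj; have [/(ltn_trans aj)] := lej a aJ; rewrite ltnn.
Qed.

(** * The bijection *)

Lemma phi_avoids132 n (s : 'S_n) : avoids132 s ->
  [/\ dyck_from 0 (phi s), downs (phi s) = n & decode 0 (phi s) = code s].
Proof.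
move=> /avoids132_step_ok sP; rewrite phi_build //.
rewrite dyck_from_build // downs_build size_code decodeK //; split=> //.
(* Nothing follows the last position, so the code ends with 0 and the path returns to the axis. *)
rewrite (last_nth 0) size_code; case: n s sP => [|n] s _ //=.
by rewrite (nth_code s ord_max) -leqn0 -ltnS (leq_trans (larger_after_lt s _)) //= subSnn.
Qed.

Theorem theorem1 (n p : nat) (hn : 0 < n) (hp : 1 <= p) (hpn : p <= n) :
  set_bij
    [set s : 'S_n | avoids pat132 s /\ avoids_hat (1%g : 'S_p.+1) ord0 s]%classic
    [set w : lattice_path | dyck n w /\ ~ peak_at_height w p]%classic
    (@phi n).
Proof.
have peakE (s : 'S_n) : avoids132 s ->
    ~ peak_at_height (phi s) p <-> avoids_hat (1%g : 'S_p.+1) ord0 s.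
  move=> sP; have [w_dyck _ _] := phi_avoids132 sP.
  have s_ok : path step_ok 0 (code s) by apply/avoids132_step_ok.
  rewrite peak_at_heightP // phi_build // has_peak_build //.
  rewrite avoids_hat_lr_min // -no_peak_lr_min //.
  by split=> [/negP|?]; [rewrite negbK | apply/negP; rewrite negbK].
split=> [s [/avoids_pat132P sP hatP]|s t|w [/dyckP[w_dyck dw] nopeak]].
- have [w_dyck dw _] := phi_avoids132 sP.
  by split; [apply/dyckP | apply/peakE].
- move=> /set_mem[/avoids_pat132P sP _] /set_mem[/avoids_pat132P tP _] eq_phi.
  have [_ _ eq_s] := phi_avoids132 sP; have [_ _ eq_t] := phi_avoids132 tP.
  apply: larger_after_inj; apply/ffunP => i; rewrite !ffunE -!nth_code.
  by rewrite -eq_s -eq_t eq_phi.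
(* The preimage of [w] is the permutation whose code is the list of heights decoded from [w]. *)
- have [hs_ok hs0 hsK] := decode_spec w_dyck.
  have sz_hs : size (decode 0 w) = n by rewrite size_decode.
  have [i ltin|s code_s] := @code_onto n _ sz_hs.
    by have := nth_path_step hs_ok hs0; rewrite sz_hs; apply.
  have s_ok : path step_ok 0 (code s) by rewrite code_s.
  have sP : avoids132 s by apply/avoids132_step_ok.
  have phi_s : phi s = w by rewrite phi_build // code_s.
  exists s => //; split; first exact/avoids_pat132P.
  by apply/peakE; rewrite ?phi_s.
Qed.
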